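(* Let $\mathfrak{T}$ be a locally finite tree in which every vertex $x$ has a finite number $\nu(x)\ge 3$ of neighbours, and let $\omega$ be a fixed geodesic ray in $\mathfrak{T}$. Then the centred triangular maximal operator $\mathcal{T}$ (associated with $\omega$) is bounded on $L^p(\mathfrak{T})$ for every $p\in[1,\infty]$.
   Context: A tree is a connected graph with no loops (cycles); it is identified with its set of vertices, endowed with the graph distance $d$ and the counting measure $\mu$; $|E|$ denotes the cardinality of $E\subseteq\mathfrak{T}$, and $L^p(\mathfrak{T})=L^p(\mathfrak{T},\mu)$. The number $\nu(x)$ of neighbours of $x$ is finite for every $x$, but $\nu$ need not be bounded on $\mathfrak{T}$. A geodesic ray is a sequence $\omega=\{x_m:m\in\mathbb{N}\}$ of vertices with $d(x_i,x_j)=|i-j|$ for all $i,j$. Fix such a ray $\omega$. The height function is $h(x)=\lim_{m\to\infty}\big(m-d(x,x_m)\big)\in\mathbb{Z}$. Each vertex $x$ has exactly one neighbour of height $h(x)+1$, and its other $\nu(x)-1$ neighbours, called the successors of $x$, have height $h(x)-1$. Let $s^0(x)=\{x\}$, let $s^1(x)$ be the set of successors of $x$, and $s^k(x)=\bigcup_{y\in s^{k-1}(x)}s^1(y)$ for $k\ge2$. For an integer $R\ge0$, the triangle with vertex $x$ and height $R$ is $T_R(x)=\bigcup_{j=0}^R s^j(x)$. The centred triangular maximal operator is $$\mathcal{T}f(x)=\sup_{R\ge0}\frac{1}{|T_R(x)|}\int_{T_R(x)}|f|\,d\mu .$$ An operator $S$ of this kind is bounded on $L^p$ if there is a constant $C$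 with $\|Sf\|_p\le C\|f\|_p$ for all $f\in L^p(\mathfrak{T})$. *)

(* Defs.v *)
From HB Require Import structures.
From mathcomp Require Import all_boot all_order all_algebra finmap.
From mathcomp Require Import all_classical all_reals all_analysis.

Set Implicit Arguments.
Unset Strict Implicit.
Unset Printing Implicit Defensive.

Import Order.TTheory GRing.Theory Num.Theory.
Import numFieldTopology.Exports.

Local Open Scope classical_set_scope.
Local Open Scope ring_scope.

Section Trees.
Variables (T : pointedType) (e : rel T).

Record is_tree : Prop := IsTree {
  tree_sym : symmetric e ;
  tree_irrefl : irreflexive e ;
  tree_connected : forall x y : T, exists2 s : seq T, path e x s & last x s = y ;
  tree_acyclic : forall c : seq T, (2 < size c)%N -> ~ ucycle e c
}.

Definition neighbours (x : T) : set T := [set y | e x y].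

Definition locally_finite : Prop := forall x : T, finite_set (neighbours x).

(* [fset_set A] is [fset0] when [A] is infinite, so this is the valency only
   at the vertices with finitely many neighbours. *)
Definition valency (x : T) : nat := #|` fset_set (neighbours x) |.

Definition walk (x y : T) (n : nat) : bool :=
  `[< exists s : seq T, [/\ path e x s, last x s = y & size s = n] >].

(* The length of a shortest walk; the value 0 in the second branch is never
   taken in a connected graph. *)
Definition gdist (x y : T) : nat :=
  if pselect (exists n, walk x y n) is left h then ex_minn h else 0%N.

Definition geodesic_ray (w : nat -> T) : Prop :=
  forall i j : nat, gdist (w i) (w j) = `|i - j|%N.

End Trees.

Section Height.
Variables (T : pointedType) (e : rel T) (w : nat -> T) (R : realType).

(* The limit is taken in [R]; when [e] is a tree and [w] a geodesic ray the
   sequence is eventually constant, so the height is an integer. *)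
Definition height (x : T) : R :=
  limn (fun m : nat => m%:R - (gdist e x (w m))%:R : R).

(* The neighbours of [x] other than the one of height [height x + 1]. *)
Definition successors (x : T) : set T :=
  [set y | neighbours e x y /\ height y <> height x + 1].

Fixpoint descendants (k : nat) (x : T) : set T :=
  if k is k'.+1 then \bigcup_(y in descendants k' x) successors y else [set x].

Definition triangle (N : nat) (x : T) : set T :=
  \bigcup_(j in `I_N.+1) descendants j x.

End Height.

Section MaximalOperator.
Variables (T : pointedType) (R : realType).

(* The counting measure on the sigma-algebra of all subsets of [T] (the one
   generated by the family of all subsets). *)
Definition card_measure :
    {measure set (g_sigma_algebraType [set: set T]) -> \bar R} :=
  @counting (g_sigma_algebraType [set: set T]) R.

Local Open Scope ereal_scope.

Definition centred_triangular_maximal (e : rel T) (w : nat -> T) (f : T -> R)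
    (x : T) : \bar R :=
  ereal_sup [set (#|` fset_set (triangle e w R N x) |%:R^-1)%:E *
                 \int[card_measure]_(y in triangle e w R N x) `|f y|%:E
            | N in [set: nat]].

Definition bounded_on_Lp (S : (T -> R) -> T -> \bar R) (p : \bar R) : Prop :=
  exists C : R, forall f : T -> R, f \in Lfun card_measure p ->
    Lnorm card_measure p (S f) <= C%:E * Lnorm card_measure p (EFin \o f).

End MaximalOperator.

(* Main.v *)
(* Each vertex [y] lies in the triangles of its ancestors only, and it is [j]
   generations below exactly one of them.  Since a triangle of height at least
   [j] has at least [2 ^ j] vertices, the means of [|f| `^ p] over the triangles
   of vertex [x] are all bounded by
   [\sum_j 2 ^- j * \sum_(y in descendants j x) |f y| `^ p],
   and summing this over [x] gives at most [2 * \sum_y |f y| `^ p].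
   Jensen's inequality turns this weighted [L^1] bound into the [L^p] bound with
   constant [2 `^ p^-1]. *)
Require Import Defs.
From mathcomp Require Import all_boot all_order all_algebra.
From mathcomp Require Import finmap zify ring lra.
From mathcomp Require Import all_classical all_reals all_analysis ess_sup_inf.

Set Implicit Arguments.
Unset Strict Implicit.
Unset Printing Implicit Defensive.

Import Order.TTheory GRing.Theory Num.Theory.
Import numFieldTopology.Exports.

Local Open Scope classical_set_scope.
Local Open Scope ring_scope.

Lemma fset_two_elements (K : choiceType) (A : {fset K}) : (1 < #|` A|)%N ->
  exists a b, [/\ a \in A, b \in A & a != b].
Proof.
move=> A1.
have /fset0Pn[a aA] : A != fset0 by rewrite -cardfs_gt0; lia.
have /fset0Pn[b] : (A `\ a)%fset != fset0.
  by rewrite -cardfs_gt0; have := cardfsD1 a A; rewrite aA; lia.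
by rewrite !inE => /andP[ba bA]; exists a, b; rewrite eq_sym.
Qed.

(** * Distances in a tree *)

Section TreeDistance.
Variables (T : pointedType) (e : rel T).
Hypothesis e_tree : is_tree e.

Let e_sym := tree_sym e_tree.

Lemma path_rev (x : T) s : path e x s ->
  path e (last x s) (rev (belast x s)).
Proof. by rewrite rev_path (eq_path (e' := e)) // => y z /=; rewrite e_sym. Qed.

Lemma exists_walk x y : exists n, walk e x y n.
Proof.
have [s es ls] := tree_connected e_tree x y.
by exists (size s); apply/asboolP; exists s.
Qed.

Lemma gdist_le x y s : path e x s -> last x s = y -> (gdist e x y <= size s)%N.
Proof.
move=> es ls; rewrite /gdist; case: pselect => [h|/(_ (exists_walk x y))//].
by case: ex_minnP => m _; apply; apply/asboolP; exists s.
Qed.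

Lemma gdist_path x y :
  exists s, [/\ path e x s, last x s = y & size s = gdist e x y].
Proof.
rewrite /gdist; case: pselect => [h|/(_ (exists_walk x y))//].
by case: ex_minnP => m /asboolP.
Qed.

Lemma gdist_sym x y : gdist e x y = gdist e y x.
Proof.
suff le u v : (gdist e u v <= gdist e v u)%N by apply/eqP; rewrite eqn_leq !le.
have [s [es ls <-]] := gdist_path v u.
rewrite -(size_belast v) -size_rev; apply: gdist_le.
  by rewrite -ls path_rev.
by case: s es ls => //= a s _ _; rewrite rev_cons last_rcons.
Qed.

Lemma gdist_triangle y x z : (gdist e x z <= gdist e x y + gdist e y z)%N.
Proof.
have [s [es ls <-]] := gdist_path x y; have [t [et lt <-]] := gdist_path y z.
rewrite -size_cat; apply: gdist_le; first by rewrite cat_path es ls.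
by rewrite last_cat ls.
Qed.

Lemma gdist_edge x y z : e x y -> (gdist e x z <= (gdist e y z).+1)%N.
Proof.
move=> exy; have [s [es ls <-]] := gdist_path y z.
by apply: (@gdist_le _ _ (y :: s)); rewrite //= exy.
Qed.

Lemma gdist_eq0 x y : gdist e x y = 0%N -> x = y.
Proof. by have [s [_ ls <-]] := gdist_path x y => /size0nil s0; rewrite -ls s0. Qed.

(** The part of [s] after [v] is a walk from [v] to [r], and it is shorter than [s] since [s] does
    not list its starting point [x]. *)
Lemma gdist_on_geodesic x r s v : path e x s -> last x s = r ->
  size s = gdist e x r -> v \in s -> (gdist e v r < gdist e x r)%N.
Proof.
move=> es ls <- /splitPr sv; case: sv es ls => s1 s2.
rewrite cat_path last_cat size_cat /= => /and3P[_ _ es2] ls2.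
by rewrite addnS ltnS (leq_trans (gdist_le es2 ls2)) ?leq_addl.
Qed.

(* A simple path from [y] to [z] avoiding their common neighbour [x] closes up
   to a cycle through [x]. *)
Lemma no_detour x y z s : e x y -> e x z -> y != z ->
  path e y s -> last y s = z -> x \notin y :: s -> False.
Proof.
move=> exy exz yz es ls xs.
case: (shortenP es) ls => s' es' us' ss' ls'.
(* A cycle needs three vertices: [x], [y] and at least one of [s']. *)
have s'0 : (0 < size s')%N.
  by case: s' ls' {us' ss' es'} => //= yzE; rewrite yzE eqxx in yz.
apply: (tree_acyclic e_tree (c := x :: y :: s')) => //.
apply/andP; split.
  by rewrite /= exy rcons_path es' ls' e_sym.
rewrite cons_uniq us' andbT; apply: contra xs; rewrite !inE => /orP[->//|/ss' ->].
by rewrite orbT.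
Qed.

(** Following [s] from [y] to [r] and [t] backwards to [z] gives a detour around [x]. *)
Lemma common_neighbour_separates x y z r s t : e x y -> e x z -> y != z ->
  path e y s -> last y s = r -> x \notin y :: s ->
  path e z t -> last z t = r -> x \notin z :: t -> False.
Proof.
move=> exy exz yz es ls xs et lt xt.
apply: (@no_detour x y z (s ++ rev (belast z t))) => //.
- by rewrite cat_path es ls -lt path_rev.
- rewrite last_cat ls; case: t et lt xt => //= a t _ _ _.
  by rewrite rev_cons last_rcons.
- rewrite -cat_cons mem_cat negb_or xs mem_rev; apply: contra xt.
  exact: mem_belast.
Qed.

(** Shortest paths from [y] and from [z] to [r] meet only vertices closer to [r] than [x], so both
    avoid [x]. *)
Lemma closer_neighbour_unique x y z r : e x y -> e x z ->
  gdist e x r = (gdist e y r).+1 -> gdist e x r = (gdist e z r).+1 -> y = z.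
Proof.
move=> exy exz dy dz; apply/eqP; apply: contraT => yz; exfalso.
have [s [es ls ss]] := gdist_path y r; have [t [et lt st]] := gdist_path z r.
have avoids u s' : path e u s' -> last u s' = r -> size s' = gdist e u r ->
    gdist e x r = (gdist e u r).+1 -> x \notin u :: s'.
  move=> eu lu su du; rewrite inE negb_or; apply/andP; split.
    by apply/eqP => xu; move: du; rewrite xu; lia.
  by apply/negP => /(gdist_on_geodesic eu lu su); lia.
by apply: (common_neighbour_separates exy exz yz es ls _ et lt); apply: avoids.
Qed.

(** A tree has no odd cycle. With equal distances, [y] and the first vertex [x'] of a shortest path
    from [x] to [r] would be distinct neighbours of [x], both joined to [r] by paths avoiding
    [x]. *)
Lemma gdist_edge_neq x y r : e x y -> gdist e x r <> gdist e y r.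
Proof.
move=> exy dxy.
have [[|x' s] [es ls ss]] := gdist_path x r.
  have /gdist_eq0 yr : gdist e y r = 0%N by rewrite -dxy -ss.
  by move: exy ls; rewrite yr => + /= xr; rewrite xr (tree_irrefl e_tree).
have x's := gdist_on_geodesic es ls ss; move: es ls => /= /andP[exx' es] ls.
have dx' := x's x' (mem_head _ _).
have [t [et lt st]] := gdist_path y r.
apply: (common_neighbour_separates exx' exy _ es ls _ et lt).
- by apply: contraTneq dx' => ->; rewrite dxy ltnn.
- by apply/negP => /x's; rewrite ltnn.
- rewrite inE negb_or; apply/andP; split.
    by apply: contraTneq exy => <-; rewrite (tree_irrefl e_tree).
  by apply/negP => /(gdist_on_geodesic et lt st); rewrite dxy ltnn.
Qed.

Lemma gdist_edge_cases x y r : e x y ->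
  gdist e x r = (gdist e y r).+1 \/ gdist e y r = (gdist e x r).+1.
Proof.
move=> exy; have := gdist_edge r exy; have := gdist_edge_neq (r := r) exy.
by move: exy; rewrite e_sym => /(gdist_edge r); lia.
Qed.

(** The endpoints of walks of exactly [n] edges from [point] form a finite set [ball n], and
    connectedness makes these sets cover [T]. *)
Lemma countable_locally_finite : locally_finite e -> countable [set: T].
Proof.
move=> e_fin.
pose ball := fix B n : set T :=
  if n is n'.+1 then \bigcup_(y in B n') neighbours e y else [set point].
have fB n : finite_set (ball n).
  by elim: n => [|n IH] /=; [exact: finite_set1|exact: bigcup_finite].
have -> : [set: T] = \bigcup_n ball n.
  apply/seteqP; split => // x _.
  have [s] := tree_connected e_tree point x.
  elim/last_ind: s x => [|s y IH] x /=; first by move=> _ <-; exists 0%N.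
  rewrite rcons_path last_rcons => /andP[es ey] <-.
  have [n _ Bn] := IH _ es erefl.
  by exists n.+1 => //; exists (last point s).
apply: bigcup_countable; first exact: countableP.
by move=> n _; apply: finite_set_countable; exact: fB.
Qed.

End TreeDistance.

(** * The height function along the ray *)

Section TreeHeight.
Variables (T : pointedType) (e : rel T) (w : nat -> T) (R : realType).
Hypothesis e_tree : is_tree e.
Hypothesis w_ray : geodesic_ray e w.

Local Notation h := (height e w R).

(* Along the ray [gdist x (w m) + gdist x (w 0) - m] is a nonincreasing
   sequence of natural numbers. *)
Lemma height_eventually x :
  exists M k : nat, forall m, (M <= m)%N ->
    (gdist e x (w m) + gdist e x (w 0) = m + k)%N.
Proof.
pose k m := (gdist e x (w m) + gdist e x (w 0) - m)%N.
(* By the triangle inequality the subtraction in [k m] is not truncated. *)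
have km m : (gdist e x (w m) + gdist e x (w 0) = m + k m)%N.
  have := gdist_triangle e_tree x (w m) (w 0).
  by rewrite w_ray (gdist_sym e_tree (w m) x) /k; lia.
have kS m : (k m.+1 <= k m)%N.
  have := gdist_triangle e_tree (w m) x (w m.+1); rewrite w_ray.
  by have := km m; have := km m.+1; lia.
have kle m n : (m <= n)%N -> (k n <= k m)%N.
  elim: n => [|n IH]; first by rewrite leqn0 => /eqP ->.
  by rewrite leq_eqVlt => /predU1P[->//|/IH]; exact: leq_trans.
(* Once the nonincreasing sequence [k] reaches its minimum [v], it stays there. *)
have [v [M kM] vmin] : exists2 v, (exists M, k M = v) & forall n, (v <= k n)%N.
  have ex : exists v, `[< exists M, k M = v >].
    by exists (k 0%N); apply/asboolP; exists 0%N.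
  exists (ex_minn ex); case: ex_minnP => v /asboolP // _ vmin n.
  by apply: vmin; apply/asboolP; exists n.
exists M, v => m Mm; rewrite km; have := kle _ _ Mm; have := vmin m; lia.
Qed.

Lemma heightE x :
  exists M, forall m, (M <= m)%N -> h x = m%:R - (gdist e x (w m))%:R.
Proof.
have [M [k Mk]] := height_eventually x.
have u m : (M <= m)%N ->
    m%:R - (gdist e x (w m))%:R = (gdist e x (w 0))%:R - k%:R :> R.
  move=> /Mk /(congr1 (fun n => n%:R : R)); rewrite !natrD; lra.
exists M => m /u ->; apply/cvg_lim => //.
apply: cvg_near_cst; exists M => // n /= Mn; exact: u.
Qed.

(** Far along the ray [h y - h x] is the difference of the distances to [w m]. The case found at the
    single index [K] fixes this difference, hence the case at every later index. *)
Lemma height_edge x y : e x y ->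
  (exists M, forall m, (M <= m)%N -> gdist e x (w m) = (gdist e y (w m)).+1)
    /\ h y = h x + 1 \/
  (exists M, forall m, (M <= m)%N -> gdist e y (w m) = (gdist e x (w m)).+1)
    /\ h x = h y + 1.
Proof.
move=> exy; have [M Mx] := heightE x; have [N Ny] := heightE y.
pose K := maxn M N.
have K2 m : (K <= m)%N -> (M <= m)%N /\ (N <= m)%N by rewrite /K; lia.
have hd m : (K <= m)%N -> h y - h x = (gdist e x (w m))%:R - (gdist e y (w m))%:R.
  by move=> /K2[/Mx -> /Ny ->]; lra.
have [dK|dK] := gdist_edge_cases e_tree (w K) exy; [left|right].
  have hxy : h y = h x + 1 by have := hd K (leqnn _); rewrite dK -natr1; lra.
  split => //; exists K => m /hd; rewrite hxy => hm.
  by apply/eqP; rewrite -(eqr_nat R) -natr1; apply/eqP; lra.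
have hxy : h x = h y + 1 by have := hd K (leqnn _); rewrite dK -natr1; lra.
split => //; exists K => m /hd; rewrite hxy => hm.
by apply/eqP; rewrite -(eqr_nat R) -natr1; apply/eqP; lra.
Qed.

(** A neighbour of greater height is one closer to all far vertices of the ray, and only one
    neighbour is closer to a given vertex. *)
Lemma upper_neighbour_unique x y z : e x y -> e x z ->
  h y = h x + 1 -> h z = h x + 1 -> y = z.
Proof.
move=> exy exz hy hz.
have [[[M dy] _]|[_ hx]] := height_edge exy; last by exfalso; lra.
have [[[N dz] _]|[_ hx]] := height_edge exz; last by exfalso; lra.
apply: (closer_neighbour_unique e_tree (r := w (maxn M N)) exy exz).
  by apply: dy; lia.
by apply: dz; lia.
Qed.

(** * Generations of descendants and their disjointness *)

Local Notation successors := (successors e w R).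
Local Notation descendants := (descendants e w R).
Local Notation triangle := (triangle e w R).

Lemma height_successor x y : successors x y -> h x = h y + 1.
Proof. by case=> /height_edge[[_ ->]|[_ ->]]. Qed.

Lemma successor_parent_unique x x' y :
  successors x y -> successors x' y -> x = x'.
Proof.
move=> xy x'y; apply: (@upper_neighbour_unique y).
- by rewrite (tree_sym e_tree); case: xy.
- by rewrite (tree_sym e_tree); case: x'y.
- exact: height_successor xy.
- exact: height_successor x'y.
Qed.

Lemma height_descendant j x y : descendants j x y -> h x = h y + j%:R.
Proof.
elim: j y => [|j IH] y /=; first by move=> ->; rewrite addr0.
by case=> z /IH -> /height_successor ->; rewrite -natr1; lra.
Qed.

(** Parents are unique, so a vertex determines its ancestor [j] generations up. *)
Lemma trivIset_generation j : trivIset setT (descendants j).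
Proof.
move=> x x' _ _ [y []]; elim: j y => [|j IH] y /=; first by move=> ->.
move=> [z xz zy] [z' x'z' z'y].
by rewrite (successor_parent_unique z'y zy) in x'z'; exact: IH x'z'.
Qed.

(** The height of a descendant of [x] determines its generation. *)
Lemma trivIset_descendants x : trivIset setT (descendants ^~ x).
Proof.
move=> i j _ _ [y []] /height_descendant hi /height_descendant hj.
by apply/eqP; rewrite -(eqr_nat R); apply/eqP; lra.
Qed.

(** The definition splits off the last generation; counting by induction needs the first one split
    off instead. *)
Lemma descendantsSl k x :
  descendants k.+1 x = \bigcup_(y in successors x) descendants k y.
Proof.
elim: k => [|k IH].
  rewrite /= bigcup_set1; apply/seteqP; split => y; first by exists y.
  by move=> [z xz /= ->].
apply/seteqP; split => y.
  rewrite [X in X -> _]/=.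
  move=> [z]; rewrite -/(descendants k.+1 x) IH => -[v xv vz] zy.
  by exists v => //; exists z.
move=> [v xv [z vz zy]]; exists z => //.
by rewrite -/(descendants k.+1 x) IH; exists v.
Qed.

(** * Finiteness and exponential growth of triangles *)

Hypothesis e_fin : locally_finite e.

Lemma finite_descendants j x : finite_set (descendants j x).
Proof.
elim: j => [|j IH] /=; first exact: finite_set1.
by apply: bigcup_finite => // y _; apply: sub_finite_set (e_fin y) => z [].
Qed.

Lemma finite_triangle N x : finite_set (triangle N x).
Proof.
by apply: bigcup_finite => // j _; exact: finite_descendants.
Qed.

Hypothesis e_val : forall x, (3 <= valency e x)%N.

Local Open Scope fset_scope.

Lemma two_successors x :
  exists a b, [/\ successors x a, successors x b & a != b].
Proof.
pose n := fset_set (neighbours e x).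
pose s := fset_set (successors x).
have inn y : (y \in n) = `[< e x y >] by rewrite in_fset_set.
have fs : finite_set (successors x) by apply: sub_finite_set (e_fin x) => z [].
have ins y : (y \in s) = `[< successors x y >] by rewrite in_fset_set.
have n3 : (2 < #|` n|)%N := e_val x.
have sn : s `<=` n.
  by apply/fsubsetP => y; rewrite ins inn => /asboolP[? _]; apply/asboolP.
have s2 : (1 < #|` s|)%N.
  (* Otherwise two distinct neighbours would fail to be successors, and both would be the upper
     neighbour of [x]. *)
  rewrite ltnNge; apply/negP => s1.
  have : (1 < #|` n `\` s|)%N by rewrite cardfsDS //; lia.
  move=> /fset_two_elements[a [b []]]; rewrite !inE !ins !inn.
  have up y : ~~ `[< successors x y >] && `[< e x y >] -> e x y /\ (h y = h x + 1)%R.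
    move=> /andP[/asboolP ny /asboolP exy]; split=> //.
    by apply: contra_notP ny.
  move=> /up[exa ha] /up[exb hb] /eqP; apply.
  exact: (upper_neighbour_unique exa exb).
have [a [b [as_ bs ab]]] := fset_two_elements s2.
by exists a, b; split=> //; apply/asboolP; rewrite -ins.
Qed.

(** Two distinct successors have disjoint sets of descendants, so the lower bound doubles with each
    generation. *)
Lemma descendants_card k x : (2 ^ k <= #|` fset_set (descendants k x)|)%N.
Proof.
elim: k x => [|k IH] x; first by rewrite /= fset_set1 cardfs1.
have [a [b [xa xb ab]]] := two_successors x.
pose F y := fset_set (descendants k y).
have inF y z : (z \in F y) = `[< descendants k y z >].
  by rewrite in_fset_set //; exact: finite_descendants.
have F0 : F a `&` F b = fset0.
  apply/fsetP => z; rewrite !inE !inF.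
  apply/negbTE/negP => /andP[/asboolP az /asboolP bz].
  by move/eqP: ab; apply; apply: (trivIset_generation (j := k)) => //; exists z.
have : F a `|` F b `<=` fset_set (descendants k.+1 x).
  apply/fsubsetP => z; rewrite !inE !inF in_fset_set; last exact: finite_descendants.
  by rewrite inE descendantsSl => /orP[]/asboolP; [exists a|exists b].
move=> /fsubset_leq_card; apply: leq_trans.
by rewrite cardfsU F0 cardfs0 subn0 expnS mul2n -addnn leq_add //; exact: IH.
Qed.

Lemma triangle_card j N x : (j <= N)%N ->
  (2 ^ j <= #|` fset_set (triangle N x)|)%N.
Proof.
move=> jN; apply: leq_trans (descendants_card j x) _.
apply: fsubset_leq_card; apply/fsubsetP => z.
rewrite !in_fset_set; [|exact: finite_triangle|exact: finite_descendants].
by rewrite !inE => xz; exists j => //=; rewrite ltnS.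
Qed.

End TreeHeight.

(* Jensen's inequality for [t `^ p] and the uniform weights, obtained by
   averaging Young's inequality for [f i] and [M `^ (p - 1)], [M] the mean. *)
Lemma powR_mean (R : realType) (I : Type) (r : seq I) (f : I -> R) (p : R) :
  1 <= p -> (0 < size r)%N -> (forall i, 0 <= f i) ->
  ((size r)%:R^-1 * \sum_(i <- r) f i) `^ p <=
    (size r)%:R^-1 * \sum_(i <- r) f i `^ p.
Proof.
(* The case [p = 1] is separate because the conjugate exponent [p / (p - 1)] requires [1 < p]. *)
rewrite le_eqVlt => /predU1P[<- r0 f0|p1 r0 f0].
  rewrite powRr1; last by rewrite mulr_ge0 ?invr_ge0 // sumr_ge0.
  by under [X in _ <= _ * X]eq_bigr => i _ do rewrite powRr1 //.
set n := (size r)%:R; set S := \sum_(i <- r) f i.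
have n0 : 0 < n :> R by rewrite ltr0n.
set M := n^-1 * S.
have M0 : 0 <= M by rewrite mulr_ge0 ?invr_ge0 ?sumr_ge0 // ltW.
have p0 : 0 < p by lra.
have pN0 : p != 0 by rewrite gt_eqF.
have p1N0 : p - 1 != 0 by rewrite gt_eqF // subr_gt0.
have q0 : 0 < p / (p - 1) by rewrite divr_gt0 // subr_gt0.
have pq : p^-1 + (p / (p - 1))^-1 = 1 by field; rewrite pN0 p1N0.
have young i : f i * M `^ (p - 1) <= f i `^ p / p + M `^ p * (1 - p^-1).
  have -> : 1 - p^-1 = (p / (p - 1))^-1 by field; rewrite pN0 p1N0.
  have -> : M `^ p = (M `^ (p - 1)) `^ (p / (p - 1)).
    by rewrite -powRrM; congr (_ `^ _); field.
  by apply: conjugate_powR => //; exact: powR_ge0.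
have : \sum_(i <- r) f i * M `^ (p - 1) <=
    \sum_(i <- r) (f i `^ p / p + M `^ p * (1 - p^-1)) by exact: ler_sum.
rewrite -mulr_suml -/S big_split /= -mulr_suml big_const_seq count_predT.
rewrite iter_addr_0 -mulr_natl -/n.
(* The left side becomes [n] times the [p]-th power of [M]; this also occurs on the right and
   cancels, leaving the claim multiplied by [n / p]. *)
have -> : S = n * M by rewrite /M mulVKf // gt_eqF.
rewrite -mulrA mulr_powRB1 // mulrBr mulr1 mulrBr addrCA lerDl subr_ge0.
rewrite mulrA ler_pM2r ?invr_gt0 // => le.
by rewrite -(ler_pM2l n0) mulVKf // gt_eqF.
Qed.

(** * Unordered sums and integrals for the counting measure *)

Local Open Scope ereal_scope.

(** Disjointness makes the second projection injective on the pairs [(i, k)] with [k] in [J i]. *)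
Lemma esum_trivIset (R : realType) (I K : choiceType) (D : set I)
    (J : I -> set K) (a : K -> \bar R) :
  trivIset D J -> (forall k, 0 <= a k) ->
  \esum_(k in \bigcup_(i in D) J i) a k = \esum_(i in D) \esum_(k in J i) a k.
Proof.
move=> tJ a0; rewrite esum_esum//; apply: reindex_esum => //; split.
- by move=> [/= i j] [Di Jij]; exists i.
- move=> [/= i1 j1] [/= i2 j2]; rewrite !inE /= => -[D1 J1] [D2 J2] j12.
  congr (_, _) => //; apply: (tJ i1 i2) => //.
  by exists j1; split=> //; rewrite j12.
- by move=> j [i Di Jij]/=; exists (i, j).
Qed.

Lemma esum_subset (R : realType) (K : choiceType) (A B : set K)
    (a : K -> \bar R) : A `<=` B ->
  \esum_(k in A) a k <= \esum_(k in B) a k.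
Proof.
move=> AB; apply: ge_ereal_sup => _ [X [fX XA] <-].
by apply: esum_ge; exists X => //; split => // k /XA /AB.
Qed.

Section CardMeasure.
Variables (T : pointedType) (R : realType).
Local Notation mu := (@card_measure T R).
Local Notation T' := (g_sigma_algebraType [set: set T]).

Lemma card_measurable (A : set T') : measurable A.
Proof. exact: sub_sigma_algebra. Qed.

Lemma card_measurable_fun d (U : sigmaRingType d) (D : set T') (f : T' -> U) :
  measurable_fun D f.
Proof. by move=> _ Y _; exact: card_measurable. Qed.

Lemma card_measure1 x : mu [set x] = 1.
Proof. by rewrite /card_measure /= /counting asboolT // fset_set1 cardfs1. Qed.

(** Singletons have mass 1, so null sets are empty. *)
Lemma card_measure_ae (P : T' -> Prop) : {ae mu, forall x, P x} -> forall x, P x.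
Proof.
move=> [N [_ N0 PN]] x; apply: contrapT => nP; have Nx := PN x nP.
have : mu [set x] <= mu N.
  by apply: le_measure; rewrite ?inE; try exact: card_measurable; move=> _ ->.
by rewrite card_measure1 N0 lee_fin ler10.
Qed.

Lemma integral_card1 x (g : T -> \bar R) : \int[mu]_(y in [set x]) g y = g x.
Proof.
rewrite (eq_integral (cst (g x))); last by move=> y /[!inE] ->.
rewrite integral_cst; last exact: card_measurable.
by rewrite card_measure1 mule1.
Qed.

(** Both sides split over the fibres [F k] of an injection into the natural numbers, each empty or a
    singleton. *)
Lemma integral_card (D : set T) (g : T -> \bar R) :
  countable [set: T] -> (forall x, 0 <= g x) ->
  \int[mu]_(x in D) g x = \esum_(x in D) g x.
Proof.
move=> /countable_injP[c cI] g0.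
have cinj x y : c x = c y -> x = y by apply: cI; rewrite inE.
pose F k := [set x | D x /\ c x = k].
have DF : D = \bigcup_k F k.
  apply/seteqP; split=> x; first by move=> Dx; exists (c x).
  by case=> k _ [].
have tF : trivIset setT F by move=> i j _ _ [x [[_ <-] [_ <-]]].
rewrite [in RHS]DF nneseries_sum_bigcup// DF ge0_integral_bigcup //; last 2 first.
- by move=> k; exact: card_measurable.
- exact: card_measurable_fun.
apply: eq_eseriesr => k _.
have [[x Fx]|F0] := pselect (exists x, F k x); last first.
  have -> : F k = set0 by apply/seteqP; split=> // x Fx; apply: F0; exists x.
  by rewrite integral_set0 esum_set0.
have -> : F k = [set x].
  apply/seteqP; split=> y; last by move=> ->.
  by case: Fx => _ <- [_ /cinj].
by rewrite integral_card1 esum_set1.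
Qed.

End CardMeasure.

Lemma le_poweR (R : realType) (a b : \bar R) (r : R) : (0 <= r)%R ->
  0 <= a -> a <= b -> a `^ r <= b `^ r.
Proof.
move=> r0 a0 ab; apply: gt0_ler_poweR => //.
  by rewrite in_itv /= a0 leey.
by rewrite in_itv /= (le_trans a0 ab) leey.
Qed.

(** * Bounds for the maximal operator *)

Section MaximalOperator.
Variables (R : realType) (T : pointedType) (e : rel T) (w : nat -> T).
Hypothesis e_tree : is_tree e.
Hypothesis e_fin : locally_finite e.
Hypothesis e_val : forall x, (3 <= valency e x)%N.
Hypothesis w_ray : geodesic_ray e w.

Local Notation mu := (@card_measure T R).
Local Notation s := (descendants e w R).
Local Notation triangle := (triangle e w R).
Local Notation maximal := (@centred_triangular_maximal T R e w).

Let T_countable := countable_locally_finite e_tree e_fin.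

Lemma triangle_card_gt0 N x : (0 < #|` fset_set (triangle N x)|)%N.
Proof. exact: leq_trans (triangle_card R e_tree w_ray e_fin e_val x (leq0n N)). Qed.

Lemma integral_triangle (u : T -> R) N x : (forall y, (0 <= u y)%R) ->
  \int[mu]_(y in triangle N x) (u y)%:E =
  (\sum_(y <- fset_set (triangle N x)) u y)%:E.
Proof.
move=> u0; rewrite integral_card => [|//|y]; last by rewrite lee_fin.
rewrite esum_fset; last 2 first.
- exact: finite_triangle.
- by move=> y _; rewrite lee_fin.
by rewrite fsbig_finite ?sumEFin //; exact: finite_triangle.
Qed.

(* A majorant of the means of [u] over all the triangles with vertex [x]:
   [triangle N x] is the disjoint union of the generations [j <= N] and has at
   least [2 ^ j] elements for each of them. *)
Definition generation_sum (u : T -> R) (x : T) : \bar R :=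
  \sum_(j <oo) \esum_(y in s j x) ((2 ^- j) * u y)%:E.

Lemma triangle_mean_le (u : T -> R) N x : (forall y, (0 <= u y)%R) ->
  (#|` fset_set (triangle N x)|%:R^-1 *
     \sum_(y <- fset_set (triangle N x)) u y)%:E <= generation_sum u x.
Proof.
move=> u0; set n := #|` _|%:R.
have n0 : (0 < n :> R)%R by rewrite ltr0n triangle_card_gt0.
have nu0 y : (0 <= n^-1 * u y)%R by rewrite mulr_ge0 // invr_ge0 ltW.
have su0 j y : (0 <= 2 ^- j * u y)%R by rewrite mulr_ge0 // invr_ge0 exprn_ge0.
(* The factor [n^-1] moves inside the sum, to be compared with [2 ^- j] generation by generation. *)
rewrite mulr_sumr -(integral_triangle N x nu0) integral_card => [|//|y]; last first.
  by rewrite lee_fin.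
rewrite /Defs.triangle esum_bigcupT; last 2 first.
- exact: trivIset_descendants.
- by move=> y; rewrite lee_fin.
rewrite /generation_sum nneseries_esumT; last first.
  by move=> j; apply: esum_ge0 => y _; rewrite lee_fin.
apply: le_trans (esum_subset _ (subsetT _)).
apply: le_esum => j /=; rewrite ltnS => jN; apply: le_esum => y _.
rewrite lee_fin ler_wpM2r // lef_pV2 ?posrE ?exprn_gt0 //.
rewrite -natrX ler_nat; exact: (triangle_card R e_tree w_ray e_fin e_val).
Qed.

Lemma integral_generation_sum (u : T -> R) : (forall y, (0 <= u y)%R) ->
  \int[mu]_x generation_sum u x <= 2%:E * \int[mu]_x (u x)%:E.
Proof.
move=> u0.
have su0 j y : (0 <= 2 ^- j * u y)%R by rewrite mulr_ge0 // invr_ge0 exprn_ge0.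
have sums0 j x : 0 <= \esum_(y in s j x) (2 ^- j * u y)%:E.
  by apply: esum_ge0 => y _; rewrite lee_fin.
have Iu0 : 0 <= \int[mu]_x (u x)%:E by apply: integral_ge0 => y _; rewrite lee_fin.
rewrite /generation_sum integral_nneseries //; last first.
  by move=> j; exact: card_measurable_fun.
(* For fixed [j] the sets [s j x] are disjoint, so each [y] is counted at most once. *)
have gen j : \int[mu]_x (\esum_(y in s j x) (2 ^- j * u y)%:E) <=
    (2 ^- j)%:E * \int[mu]_x (u x)%:E.
  rewrite integral_card // -esum_trivIset; last 2 first.
  - exact: (trivIset_generation (w := w) (R := R) e_tree w_ray).
  - by move=> y; rewrite lee_fin.
  apply: le_trans (esum_subset _ (subsetT _)) _.
  rewrite -integral_card => [|//|y]; last by rewrite lee_fin.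
  under eq_integral do rewrite EFinM.
  rewrite ge0_integralZl_EFin // ?invr_ge0 ?exprn_ge0 //.
  - by move=> y _; rewrite lee_fin.
  - exact: card_measurable_fun.
apply: le_trans (lee_nneseries _ (fun j _ => gen j)) _.
  by move=> j *; exact: integral_ge0.
have [Iy|Ify] := eqVneq (\int[mu]_x (u x)%:E) +oo.
  by rewrite Iy gt0_muley ?leey // lte_fin.
have /fineK I : \int[mu]_x (u x)%:E \is a fin_num by rewrite ge0_fin_numE // ltey.
rewrite -I; set c := fine _; have c0 : (0 <= c)%R by rewrite fine_ge0.
(* The geometric series enters with epsilon [2 * c], whose share at index [j] is [2 * c] over
   [2 ^ j.+1], that is [2 ^- j * c]. *)
rewrite -EFinM; apply: le_trans (epsilon_trick0 xpredT _); last by rewrite mulr_ge0.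
apply: lee_nneseries => j _; first by rewrite lee_fin mulr_ge0 // invr_ge0 exprn_ge0.
rewrite -EFinM lee_fin natrX exprS invfM mulrA (mulrAC 2%R).
rewrite mulfV ?pnatr_eq0 // mul1r.
by rewrite mulrC.
Qed.

Lemma maximal_leP (f : T -> R) x (M : \bar R) :
  (forall N, (#|` fset_set (triangle N x)|%:R^-1 *
     \sum_(y <- fset_set (triangle N x)) `|f y|)%:E <= M) ->
  maximal f x <= M.
Proof.
move=> fM; apply: ge_ereal_sup => _ [N _ <-].
by rewrite integral_triangle // -EFinM.
Qed.

Lemma maximal_ge0 (f : T -> R) x : 0 <= maximal f x.
Proof.
apply: (@le_trans _ _ ((#|` fset_set (triangle 0 x)|%:R^-1)%:E *
    \int[mu]_(y in triangle 0 x) `|f y|%:E)).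
  by rewrite integral_triangle // -EFinM lee_fin mulr_ge0 ?invr_ge0 ?sumr_ge0.
by apply: ereal_sup_ubound; exists 0%N.
Qed.

Lemma maximal_Lnorm_oo (f : T -> R) :
  Lnorm mu +oo (maximal f) <= Lnorm mu +oo (EFin \o f).
Proof.
rewrite unlock /Lnorm; case: ifPn => // mu0; apply/ess_supP.
have fle y : `|(f y)%:E| <= ess_sup mu (abse \o (EFin \o f)).
  exact: (card_measure_ae (ess_sup_ge mu (abse \o (EFin \o f)))) y.
move: fle; set M := ess_sup _ _ => fle.
apply: aeW => x /=; rewrite gee0_abs ?maximal_ge0 //; apply: maximal_leP => N.
(* The bound [M] may be [+oo], which is trivial; [-oo] contradicts the bound on [f] at [x]. *)
case: M fle => [r|_|/(_ x)//]; last by rewrite leey.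
move=> fr; rewrite lee_fin ler_pdivrMl ?ltr0n ?triangle_card_gt0 //.
apply: (@le_trans _ _ (\sum_(y <- fset_set (triangle N x)) r)%R).
  by apply: ler_sum => y _; have := fr y; rewrite lee_fin.
by rewrite big_const_seq count_predT iter_addr_0 mulr_natl.
Qed.

Lemma maximal_Lnorm (p : R) (f : T -> R) : (1 <= p)%R ->
  Lnorm mu p%:E (maximal f) <=
    (2 `^ p^-1)%:E * Lnorm mu p%:E (EFin \o f).
Proof.
move=> p1; have p0 : (0 < p)%R by rewrite (lt_le_trans _ p1).
have pV0 : (0 <= p^-1)%R by rewrite invr_ge0 ltW.
pose u y := (`|f y| `^ p)%R.
have u0 y : (0 <= u y)%R by exact: powR_ge0.
have G0 x : 0 <= generation_sum u x.
  apply: nneseries_ge0 => j _ _; apply: esum_ge0 => y _.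
  by rewrite lee_fin mulr_ge0 // invr_ge0 exprn_ge0.
have max_le x : `|maximal f x| `^ p <= generation_sum u x.
  rewrite gee0_abs ?maximal_ge0 //.
  (* Writing the right side as the [p]-th power of its [p]-th root reduces the claim to a bound on
     the supremum itself, hence on each mean. *)
  rewrite -[leRHS]poweRe1 // -(mulVf (lt0r_neq0 p0)) poweRrM.
  apply: le_poweR; [exact: ltW|exact: maximal_ge0|].
  apply: maximal_leP => N.
  set a := (X in X%:E <= _).
  have a0 : (0 <= a)%R by rewrite mulr_ge0 ?invr_ge0 ?sumr_ge0.
  (* The mean [a] is the [p]-th root of its [p]-th power, to which Jensen's inequality applies. *)
  rewrite -(powRr1 a0) -(mulfV (lt0r_neq0 p0)) powRrM -poweR_EFin.
  apply: le_poweR; rewrite ?lee_fin ?powR_ge0 //.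
  apply: le_trans (triangle_mean_le N x u0).
  by rewrite lee_fin powR_mean // triangle_card_gt0.
rewrite unlock /Lnorm -poweR_EFin -poweRM ?lee_fin //; last first.
  by apply: integral_ge0 => x _; exact: poweR_ge0.
apply: le_poweR => //; first by apply: integral_ge0 => x _; exact: poweR_ge0.
apply: le_trans (integral_generation_sum u0).
apply: ge0_le_integral => //.
- by move=> x _; exact: poweR_ge0.
- exact: card_measurable_fun.
- exact: card_measurable_fun.
Qed.

End MaximalOperator.

Theorem theorem3p1 (R : realType) (T : pointedType) (e : rel T) (w : nat -> T)
    (e_tree : is_tree e) (e_fin : locally_finite e)
    (e_val : forall x : T, (3 <= valency e x)%N)
    (w_ray : geodesic_ray e w)
    (p : \bar R) (p_ge1 : (1 <= p)%E) :
  bounded_on_Lp (@centred_triangular_maximal T R e w) p.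
Proof.
case: p p_ge1 => [r|_|//]; last first.
  by exists 1%R => f _; rewrite mul1e; exact: maximal_Lnorm_oo.
rewrite lee_fin => r1; exists (2 `^ r^-1)%R => f _.
exact: maximal_Lnorm.
Qed.
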